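(* Let $\delta,\varepsilon$ be real constants with $\varepsilon\ne0$. For $\mu\ge0$ put $$F_\varepsilon(\mu)=-\frac{\pi|\varepsilon|\mu}{4(\pi+\mu)}+\frac{\mu^2}{\pi+\mu}\int_{-\pi/4}^{\pi/4}\frac{\sin^2(2t)}{1+\mu\cos(2t)}\,dt,$$ and let $m(\varepsilon)=\inf_{\mu\ge0}F_\varepsilon(\mu)$. If $\delta>m(\varepsilon)$, then the Mathieu equation $$\phi''(t)+(\delta+\varepsilon\cos(2t))\phi(t)=0,\qquad t\ge t_0,$$ is oscillatory.
   Context: $t_0$ is a fixed real number. A linear equation $\phi''+q\phi=0$, $t\ge t_0$, is said to be oscillatory if every solution of it has arbitrarily large zeros. *)

(* Defs.v *)
From Stdlib Require Import Reals.
From Coquelicot Require Import Coquelicot.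
Open Scope R_scope.

(** [phi] is a twice differentiable solution of [phi'' + q phi = 0] on
    [[t0, +oo)]. [D_in] is the derivative relative to a domain, hence one-sided
    at [t0]; the values of [phi] outside the half-line are irrelevant. *)
Definition is_solution (q : R -> R) (t0 : R) (phi : R -> R) : Prop :=
  exists dphi ddphi : R -> R,
    forall t : R, t0 <= t ->
      D_in phi dphi (fun s => t0 <= s) t /\
      D_in dphi ddphi (fun s => t0 <= s) t /\
      ddphi t + q t * phi t = 0.

(** The zero solution need not be excluded: it vanishes everywhere. *)
Definition oscillatory (q : R -> R) (t0 : R) : Prop :=
  forall phi : R -> R, is_solution q t0 phi ->
    forall T : R, exists t : R, T <= t /\ t0 <= t /\ phi t = 0.

Definition F (eps mu : R) : R :=
  - (PI * Rabs eps * mu / (4 * (PI + mu)))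
  + mu ^ 2 / (PI + mu) *
    RInt (fun t => sin (2 * t) ^ 2 / (1 + mu * cos (2 * t))) (- (PI / 4)) (PI / 4).

(** The infimum is taken in the extended reals, so that its meaning does not
    depend on [F eps] being bounded below. *)
Definition m (eps : R) : Rbar :=
  Glb_Rbar (fun y => exists mu : R, 0 <= mu /\ y = F eps mu).

(* Main.v *)
Require Import Defs.
From Stdlib Require Import Reals Lra Classical.
From Coquelicot Require Import Coquelicot.
Open Scope R_scope.

(** If a solution [phi] had no zero beyond some point, then [w = phi' / phi]
    would satisfy the Riccati equation [w' = - q - w^2] there. For a weight
    [p >= 0], completing the square gives
    [(p w)' = p' w - q p - p w^2 <= p'^2 / (4 p) - q p], so the growth of [p w]
    is bounded by an integral in which [w] no longer occurs
    ([riccati_weighted_growth]). Two choices of [p] contradict each other.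

    Up to a shift of time by [PI / 2] when [eps < 0], the coefficient is
    [delta + |eps| cos (2 t)]. Take [p] of period [PI], equal to
    [1 + mu cos (2 t)] where [cos (2 t) >= 0] and to [1] elsewhere. The bound,
    integrated over a period, is exactly [(PI + mu) (F eps mu - delta)]. Since
    [delta > m eps], some [mu >= 0] makes it negative, so that [w] drops by a
    fixed amount over each period ([riccati_period_drop]) and is unbounded
    below along an arithmetic progression ([riccati_iterated_drop]).

    On the other hand [p (t) = (a + 1 - t)^2] on [[a, a + 1]] vanishes at the
    right end, and the bound becomes a lower bound on [w a] uniform in [a]
    ([riccati_lower_bound]). *)

(** * Weighted Riccati inequalities *)

(** The hypothesis [dp^2 <= 4 p e] replaces [e = dp^2 / (4 p)], so that [p] may
    vanish. *)
Lemma riccati_weighted_growth (q w p dp e : R -> R) (a b v : R) :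
  a <= b ->
  (forall t, a <= t <= b -> is_derive w t (- q t - w t ^ 2)) ->
  (forall t, a <= t <= b -> continuous q t) ->
  (forall t, a <= t <= b -> is_derive p t (dp t)) ->
  (forall t, a <= t <= b -> continuous dp t) ->
  (forall t, a <= t <= b -> 0 <= p t /\ 0 <= e t /\ dp t ^ 2 <= 4 * p t * e t) ->
  is_RInt (fun t => e t - q t * p t) a b v ->
  p b * w b - p a * w a <= v.
Proof.
  intros Hab Hw Hq Hp Hdp He Hv.
  assert (HI : is_RInt (fun t => dp t * w t + p t * (- q t - w t ^ 2)) a b
                 (p b * w b - p a * w a)).
  { apply (is_RInt_derive (fun t => p t * w t)).
    - intros t Ht; rewrite Rmin_left, Rmax_right in Ht by lra.
      apply (is_derive_mult p w t (dp t) (- q t - w t ^ 2));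
        [now apply Hp | now apply Hw | intros; apply Rmult_comm].
    - intros t Ht; rewrite Rmin_left, Rmax_right in Ht by lra.
      assert (Cw : continuous w t)
        by (apply (ex_derive_continuous w); eexists; now apply Hw).
      assert (Cp : continuous p t)
        by (apply (ex_derive_continuous p); eexists; now apply Hp).
      apply (continuous_plus (fun t => dp t * w t)
               (fun t => p t * (- q t - w t ^ 2))).
      + apply (continuous_mult dp w); auto.
      + apply (continuous_mult p (fun t => - q t - w t ^ 2)); auto.
        apply (continuous_minus (fun t => - q t) (fun t => w t ^ 2)).
        * apply (continuous_opp q); auto.
        * apply (ex_derive_continuous (fun t => w t ^ 2)).
          auto_derive; eexists; now apply Hw. }
  apply (is_RInt_le _ _ _ _ _ _ Hab HI Hv).
  intros t Ht; destruct (He t) as (Hp0 & He0 & Hd); [lra |].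
  enough (dp t * w t - p t * w t ^ 2 <= e t) by nra.
  destruct Hp0 as [Hp0 | Hp0].
  - apply Rmult_le_reg_l with (4 * p t); [lra |].
    assert (0 <= (2 * p t * w t - dp t) ^ 2) by apply pow2_ge_0.
    nra.
  - rewrite <- Hp0 in *.
    assert (dp t = 0) as -> by nra.
    lra.
Qed.

(** With the weight [(a + 1 - t)^2], which is [1] at [a] and [0] at [a + 1],
    the weighted growth is [- w a], while the
    integrand of the bound is [1 - q p <= 1 + Q]. *)
Lemma riccati_lower_bound (q w : R -> R) (a Q : R) :
  (forall t, a <= t <= a + 1 -> is_derive w t (- q t - w t ^ 2)) ->
  (forall t, a <= t <= a + 1 -> continuous q t) ->
  (forall t, a <= t <= a + 1 -> - Q <= q t) ->
  0 <= Q ->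
  - (1 + Q) <= w a.
Proof.
  intros Hw Hq HQ HQ0.
  set (g := fun t => 1 - q t * (a + 1 - t) ^ 2).
  assert (Hg : ex_RInt g a (a + 1)).
  { apply (ex_RInt_continuous g); intros t Ht.
    rewrite Rmin_left, Rmax_right in Ht by lra.
    apply (continuous_minus (fun _ => 1) (fun t => q t * (a + 1 - t) ^ 2)).
    - apply continuous_const.
    - apply (continuous_mult q (fun t => (a + 1 - t) ^ 2)); auto.
      apply (ex_derive_continuous (fun t => (a + 1 - t) ^ 2)).
      auto_derive; auto. }
  destruct Hg as [v Hv].
  assert (H1 : v <= 1 + Q).
  { replace (1 + Q) with (scal (a + 1 - a) (1 + Q))
      by (unfold scal; simpl; unfold mult; simpl; ring).
    refine (is_RInt_le _ _ _ _ _ _ _ Hv (is_RInt_const a (a + 1) (1 + Q)) _);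
      [lra |].
    intros t Ht; unfold g.
    assert (- Q <= q t) by (apply HQ; lra).
    assert (0 <= (a + 1 - t) ^ 2 <= 1) by nra.
    nra. }
  assert (H2 : (a + 1 - (a + 1)) ^ 2 * w (a + 1) - (a + 1 - a) ^ 2 * w a <= v).
  { apply (riccati_weighted_growth q w (fun t => (a + 1 - t) ^ 2)
             (fun t => - 2 * (a + 1 - t)) (fun _ => 1)); auto; try lra.
    - intros t _; auto_derive; auto; ring.
    - intros t _; apply (ex_derive_continuous (fun t => - 2 * (a + 1 - t))).
      auto_derive; auto.
    - intros t _; split; [apply pow2_ge_0 | split; [lra | nra]]. }
  nra.
Qed.

(** * The Mathieu coefficient over one period *)

Lemma continuous_mathieu (delta c t : R) :
  continuous (fun t => delta + c * cos (2 * t)) t.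
Proof.
  apply (ex_derive_continuous (fun t => delta + c * cos (2 * t))).
  auto_derive; auto.
Qed.

Lemma cos_2_nonneg (t : R) : - (PI / 4) <= t <= PI / 4 -> 0 <= cos (2 * t).
Proof. intros Ht; apply cos_ge_0; lra. Qed.

Lemma RInt_mathieu_weight (delta c mu : R) :
  is_RInt (fun t => (delta + c * cos (2 * t)) * (1 + mu * cos (2 * t)))
    (- (PI / 4)) (PI / 4) (delta * (PI / 2 + mu) + c * (1 + mu * (PI / 4))).
Proof.
  set (H := fun t => delta * t + (c + delta * mu) * (sin (2 * t) / 2)
                     + c * mu * (t / 2 + sin (2 * t) * cos (2 * t) / 4)).
  replace (delta * (PI / 2 + mu) + c * (1 + mu * (PI / 4)))
    with (minus (H (PI / 4)) (H (- (PI / 4)))).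
  - apply (is_RInt_derive H).
    + intros t _; unfold H; auto_derive; auto.
      assert (Hs := sin2_cos2 (2 * t)); unfold Rsqr in Hs.
      apply Rminus_diag_uniq.
      transitivity (c * mu / 2 * (1 - (sin (2 * t) * sin (2 * t)
                                       + cos (2 * t) * cos (2 * t)))).
      * field.
      * rewrite Hs; ring.
    + intros t _.
      apply (ex_derive_continuous
               (fun t => (delta + c * cos (2 * t)) * (1 + mu * cos (2 * t)))).
      auto_derive; auto.
  - unfold H, minus, plus, opp; simpl.
    replace (2 * (PI / 4)) with (PI / 2) by field.
    replace (2 * - (PI / 4)) with (- (PI / 2)) by field.
    rewrite sin_neg, cos_neg, sin_PI2, cos_PI2; field.
Qed.

Lemma RInt_mathieu_half (delta c : R) :
  is_RInt (fun t => delta + c * cos (2 * t)) (PI / 4) (3 * PI / 4)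
    (delta * (PI / 2) - c).
Proof.
  set (H := fun t => delta * t + c * (sin (2 * t) / 2)).
  replace (delta * (PI / 2) - c) with (minus (H (3 * PI / 4)) (H (PI / 4))).
  - apply (is_RInt_derive H).
    + intros t _; unfold H; auto_derive; auto; field.
    + intros t _; apply continuous_mathieu.
  - unfold H, minus, plus, opp; simpl.
    replace (2 * (PI / 4)) with (PI / 2) by field.
    replace (2 * (3 * PI / 4)) with (PI / 2 + PI) by field.
    rewrite neg_sin, sin_PI2; field.
Qed.

(** The weight is [1 + mu cos (2 t)] on the first half period and [1] on the
    second; the two agree at [PI / 4], and the first takes the value [1] at
    [- PI / 4] as well, so the weight is continuous and periodic. *)
Lemma riccati_period_drop (w : R -> R) (delta eps mu : R) :
  0 <= mu ->
  (forall t, - (PI / 4) <= t <= 3 * PI / 4 ->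
     is_derive w t (- (delta + Rabs eps * cos (2 * t)) - w t ^ 2)) ->
  w (3 * PI / 4) - w (- (PI / 4)) <= (PI + mu) * (F eps mu - delta).
Proof.
  intros Hmu Hw.
  assert (HPI := PI_RGT_0).
  set (f := fun t => sin (2 * t) ^ 2 / (1 + mu * cos (2 * t))).
  set (q := fun t => delta + Rabs eps * cos (2 * t)).
  set (I := RInt f (- (PI / 4)) (PI / 4)).
  assert (Hf : is_RInt f (- (PI / 4)) (PI / 4) I).
  { apply (RInt_correct f), (ex_RInt_continuous f); intros t Ht.
    rewrite Rmin_left, Rmax_right in Ht by lra.
    apply (ex_derive_continuous f); unfold f; auto_derive.
    assert (Hc := cos_2_nonneg t Ht); nra. }
  assert (H1 : (1 + mu * cos (2 * (PI / 4))) * w (PI / 4)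
               - (1 + mu * cos (2 * - (PI / 4))) * w (- (PI / 4))
               <= mu ^ 2 * I
                  - (delta * (PI / 2 + mu) + Rabs eps * (1 + mu * (PI / 4)))).
  { apply (riccati_weighted_growth q w (fun t => 1 + mu * cos (2 * t))
             (fun t => - 2 * mu * sin (2 * t)) (fun t => mu ^ 2 * f t)).
    - lra.
    - intros t Ht; apply Hw; lra.
    - intros t _; apply continuous_mathieu.
    - intros t _; auto_derive; auto; ring.
    - intros t _; apply (ex_derive_continuous (fun t => - 2 * mu * sin (2 * t))).
      auto_derive; auto.
    - intros t Ht; assert (Hc := cos_2_nonneg t Ht).
      assert (Hp : 1 <= 1 + mu * cos (2 * t)) by nra.
      split; [lra | split].
      + apply Rmult_le_pos; [apply pow2_ge_0 |].
        apply Rdiv_le_0_compat; [apply pow2_ge_0 | lra].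
      + apply Req_le; unfold f; field; lra.
    - apply (is_RInt_minus (fun t => mu ^ 2 * f t)).
      + now apply (is_RInt_scal f).
      + apply RInt_mathieu_weight. }
  assert (H2 : 1 * w (3 * PI / 4) - 1 * w (PI / 4)
               <= - (delta * (PI / 2) - Rabs eps)).
  { apply (riccati_weighted_growth q w (fun _ => 1) (fun _ => 0) (fun _ => 0)).
    - lra.
    - intros t Ht; apply Hw; lra.
    - intros t _; apply continuous_mathieu.
    - intros t _; apply (is_derive_const 1).
    - intros t _; apply continuous_const.
    - intros t _; lra.
    - apply (is_RInt_ext (fun t => opp (q t))).
      { intros t _; unfold opp; simpl; ring. }
      apply (is_RInt_opp q), RInt_mathieu_half. }
  replace (2 * - (PI / 4)) with (- (PI / 2)) in H1 by field.
  replace (2 * (PI / 4)) with (PI / 2) in H1 by field.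
  rewrite cos_neg, cos_PI2 in H1.
  replace ((PI + mu) * (F eps mu - delta))
    with (mu ^ 2 * I - delta * (PI + mu) - Rabs eps * mu * (PI / 4)).
  - lra.
  - unfold F; fold f; fold I; field; lra.
Qed.

(** * Unbounded decrease of the Riccati solution *)

Lemma cos_2_shift (t : R) (k : nat) : cos (2 * (t + INR k * PI)) = cos (2 * t).
Proof.
  replace (2 * (t + INR k * PI)) with (2 * t + 2 * INR k * PI) by ring.
  apply cos_period.
Qed.

Lemma is_derive_shift (w : R -> R) (c t l : R) :
  is_derive w (t + c) l -> is_derive (fun s => w (s + c)) t l.
Proof.
  intros H.
  replace l with (scal 1 l) by (unfold scal; simpl; unfold mult; simpl; ring).
  apply (is_derive_comp w (fun s => s + c)); auto.
  auto_derive; auto.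
Qed.

Lemma riccati_iterated_drop (w : R -> R) (delta eps mu : R) (k : nat) :
  0 <= mu ->
  (forall t, - (PI / 4) <= t ->
     is_derive w t (- (delta + Rabs eps * cos (2 * t)) - w t ^ 2)) ->
  w (- (PI / 4) + INR k * PI)
    <= w (- (PI / 4)) + INR k * ((PI + mu) * (F eps mu - delta)).
Proof.
  intros Hmu Hw; assert (HPI := PI_RGT_0).
  induction k as [| k IH].
  - simpl INR; rewrite !Rmult_0_l, !Rplus_0_r; lra.
  - assert (Hk := pos_INR k).
    assert (H := riccati_period_drop (fun t => w (t + INR k * PI)) delta eps mu Hmu).
    simpl in H.
    rewrite S_INR.
    replace (- (PI / 4) + (INR k + 1) * PI) with (3 * PI / 4 + INR k * PI) by field.
    enough (w (3 * PI / 4 + INR k * PI) - w (- (PI / 4) + INR k * PI)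
            <= (PI + mu) * (F eps mu - delta)) by lra.
    apply H; intros t Ht.
    apply is_derive_shift.
    rewrite <- (cos_2_shift t k).
    apply Hw; nra.
Qed.

Lemma riccati_no_global_solution (w : R -> R) (delta eps mu : R) :
  0 <= mu -> F eps mu < delta ->
  ~ (forall t, - (PI / 4) <= t ->
       is_derive w t (- (delta + Rabs eps * cos (2 * t)) - w t ^ 2)).
Proof.
  intros Hmu HF Hw; assert (HPI := PI_RGT_0).
  set (Q := Rabs delta + Rabs eps).
  set (d := (PI + mu) * (delta - F eps mu)).
  assert (Hd : 0 < d) by (apply Rmult_lt_0_compat; lra).
  destruct (INR_unbounded ((w (- (PI / 4)) + 1 + Q) / d)) as [k Hk].
  assert (Hk' : w (- (PI / 4)) + 1 + Q < INR k * d).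
  { apply (Rmult_lt_compat_r d) in Hk; auto.
    unfold Rdiv in Hk; rewrite Rmult_assoc, Rinv_l in Hk; lra. }
  assert (H1 := riccati_iterated_drop w delta eps mu k Hmu Hw).
  assert (Hk0 := pos_INR k).
  assert (H2 : - (1 + Q) <= w (- (PI / 4) + INR k * PI)).
  { apply (riccati_lower_bound (fun t => delta + Rabs eps * cos (2 * t))).
    - intros t Ht; apply Hw; nra.
    - intros t _; apply continuous_mathieu.
    - intros t _; unfold Q.
      assert (Hc := COS_bound (2 * t)).
      assert (He := Rabs_pos eps).
      assert (Hdl := Rle_abs (- delta)); rewrite Rabs_Ropp in Hdl.
      nra.
    - unfold Q; assert (H3 := Rabs_pos eps); assert (H4 := Rabs_pos delta); lra. }
  unfold d in Hk'; nra.
Qed.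

(** * From zero-free solutions to the Riccati equation *)

Lemma D_in_half_line_is_derive (f df : R -> R) (t0 t : R) :
  t0 < t -> D_in f df (fun s => t0 <= s) t -> is_derive f t (df t).
Proof.
  intros Ht H; apply is_derive_Reals.
  intros e He.
  destruct (H e He) as (r & Hr & Hlim).
  assert (Hm : 0 < Rmin r (t - t0)) by (apply Rmin_pos; lra).
  exists (mkposreal _ Hm); simpl; intros h Hh0 Hh.
  assert (Hh1 := Rlt_le_trans _ _ _ Hh (Rmin_l _ _)).
  assert (Hh2 := Rlt_le_trans _ _ _ Hh (Rmin_r _ _)).
  apply Rabs_def2 in Hh2.
  specialize (Hlim (t + h)); simpl in Hlim; unfold Rdist in Hlim.
  replace (t + h - t) with h in Hlim by ring.
  apply Hlim; split; auto.
  split; [lra | intros E; apply Hh0; lra].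
Qed.

Lemma riccati_of_nonvanishing (q : R -> R) (t0 T : R) (phi : R -> R) :
  is_solution q t0 phi -> t0 < T ->
  (forall t, T <= t -> phi t <> 0) ->
  exists w : R -> R, forall t, T <= t -> is_derive w t (- q t - w t ^ 2).
Proof.
  intros (dphi & ddphi & Hs) HT Hnz.
  exists (fun t => dphi t / phi t); intros t Ht.
  destruct (Hs t) as (H1 & H2 & H3); [lra |].
  apply D_in_half_line_is_derive in H1, H2; try lra.
  replace (- q t - (dphi t / phi t) ^ 2)
    with ((ddphi t * phi t - dphi t * dphi t) / phi t ^ 2).
  - apply is_derive_div; auto.
  - replace (ddphi t) with (- q t * phi t) by lra.
    field; auto.
Qed.

Lemma m_lt_witness (eps delta : R) :
  Rbar_lt (m eps) (Finite delta) -> exists mu, 0 <= mu /\ F eps mu < delta.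
Proof.
  intros H; apply NNPP; intros Hn.
  apply (Rbar_lt_not_le _ _ H).
  apply (Glb_Rbar_correct (fun y => exists mu, 0 <= mu /\ y = F eps mu)).
  intros y (mu & Hmu & ->); simpl.
  apply Rnot_lt_le; intros Hlt; apply Hn; eauto.
Qed.

(** The shift moves the maxima of [eps cos (2 t)] to the multiples of [PI]:
    for [eps < 0] these maxima lie at odd multiples of [PI / 2]. *)
Lemma mathieu_phase_shift (eps T : R) :
  exists c, T <= c /\
    forall t, eps * cos (2 * (t + c)) = Rabs eps * cos (2 * t).
Proof.
  assert (HPI := PI_RGT_0).
  destruct (INR_unbounded (T / PI)) as [k Hk].
  assert (Hk' : T < INR k * PI).
  { apply (Rmult_lt_compat_r PI) in Hk; auto.
    unfold Rdiv in Hk; rewrite Rmult_assoc, Rinv_l in Hk; lra. }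
  destruct (Rle_lt_dec 0 eps) as [He | He].
  - exists (INR k * PI); split; [lra |]; intros t.
    rewrite cos_2_shift, Rabs_pos_eq; auto.
  - exists (PI / 2 + INR k * PI); split; [lra |]; intros t.
    rewrite <- Rplus_assoc, cos_2_shift, Rabs_left by auto.
    replace (2 * (t + PI / 2)) with (2 * t + PI) by field.
    rewrite neg_cos; ring.
Qed.

Theorem corollary3 (t0 delta eps : R) (heps : eps <> 0)
  (hdelta : Rbar_lt (m eps) (Finite delta)) :
  oscillatory (fun t => delta + eps * cos (2 * t)) t0.
Proof.
  intros phi Hphi T; apply NNPP; intros Hn.
  destruct (m_lt_witness eps delta hdelta) as (mu & Hmu & HF).
  set (T1 := Rmax T t0 + 1).
  assert (HT := Rmax_l T t0); assert (Ht0 := Rmax_r T t0).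
  destruct (riccati_of_nonvanishing _ t0 T1 phi Hphi) as (w & Hw).
  - unfold T1; lra.
  - intros t Ht E; apply Hn; exists t; unfold T1 in Ht.
    repeat split; auto; lra.
  - destruct (mathieu_phase_shift eps (T1 + PI / 4)) as (c & Hc & Hcos).
    apply (riccati_no_global_solution (fun t => w (t + c)) delta eps mu Hmu HF).
    intros t Ht; apply is_derive_shift.
    rewrite <- Hcos; apply Hw; lra.
Qed.
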